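(* Let $\{\mathcal A^{(\epsilon,\delta)}\}$ be a family of randomized algorithms such that $\mathcal A^{(\epsilon,\delta)}$ is $(2\epsilon,\delta)_{2D}$-node DP whenever $2\epsilon<\log(1/\delta)$. Let $2\epsilon_2<\log\left(\frac{1}{\delta_2\cdot\mathrm{poly}(n)}\right)$. Then the algorithm which, on input $G\in\mathcal G_n$, outputs the pair $$\left(\hat L_{\epsilon_1,\delta_1}(G),\ \mathcal A^{(\epsilon_2'(G),\delta_2'(G))}(T_D(G))\right),\qquad (\epsilon_2'(G),\delta_2'(G))=\left(\frac{\epsilon_2}{\hat L_{\epsilon_1,\delta_1}(G)},\frac{\delta_2}{\hat L_{\epsilon_1,\delta_1}(G)}\right),$$ satisfies $\left(\epsilon_1+2\epsilon_2,\ e^{\epsilon_1}\left(\frac{1}{\mathrm{poly}(n)}+\delta_1\right)\right)$-node DP.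
   Context: $\mathrm{poly}(n)$ denotes a quantity of order $\Theta(n^\alpha)$ for some constant $\alpha>0$, possibly different at each occurrence. $\mathcal G_n$ is the set of unweighted undirected graphs on $[n]$; $\mathcal G_{n,D}$ is the subset with maximum degree at most $D$. $d_{node}(G,G')$ is the minimum number of nodes that must be rewired (row/column of the adjacency matrix changed) to turn $G'$ into $G$; $G\sim_{node}G'$ if $d_{node}(G,G')\le1$. A randomized algorithm $\mathcal A$ on $\mathcal G_n$ is $(\epsilon,\delta)$-node DP if $\mathbb P(\mathcal A(G)\in S)\le e^\epsilon\mathbb P(\mathcal A(G')\in S)+\delta$ for all $G\sim_{node}G'$ in $\mathcal G_n$ and measurable $S$. It is $(\epsilon,\delta)_{2D}$-node DP if this inequality holds for all $G\sim_{node}G'$ with $G,G'\in\mathcal G_{n,2D}$. Degree truncation: for $G\in\mathcal G_n$ with $a_{uv}=1$ if $(u,v)$ is an edge and $0$ otherwise, consider the linear program in variables $x_u$ ($u\in[n]$) and $w_{uv}=w_{vu}$ (unordered pairs): minimize $\sum_ux_u$ subject to $x_u\ge0$, $w_{uv}\ge0$, $a_{uv}\ge w_{uv}\ge a_{uv}-x_u-x_v$ for all $u,v$, and $\sum_{v\ne u}w_{uv}\le D$ for all $u$. Let $(x^*,w^* )$ be the optimal solution (chosen by a fixed deterministic rule). $T_D(G)$ is obtained from $G$ by removing every edge $(u,v)$ with $x_u^*\ge\frac14$ or $x_v^*\ge\frac14$; this maps $\mathcal G_n$ to $\mathcal G_{n,2D}$. Let $d_{T_D}(G)=4\sum_ux_u^*$,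 and $$\hat L_{\epsilon,\delta}(G)=\max\left\{\tfrac12,\ 5+2d_{T_D}(G)+\mathrm{Lap}\left(\tfrac8\epsilon\right)+\tfrac{8\log(1/\delta)}{\epsilon}\right\},$$ where $\mathrm{Lap}(b)$ is a Laplace random variable with scale $b$. The Laplace noise is independent of the internal randomness of the algorithms $\mathcal A^{(\epsilon,\delta)}$. *)

(* Defs.v *)
(* MathComp / MathComp-Analysis development. *)
From HB Require Import structures.
From mathcomp Require Import all_boot all_order all_algebra.
From mathcomp Require Import all_classical all_reals all_analysis.

Set Implicit Arguments.
Unset Strict Implicit.
Unset Printing Implicit Defensive.

Import Order.TTheory GRing.Theory Num.Theory.
Import numFieldNormedType.Exports.

Local Open Scope classical_set_scope.
Local Open Scope ring_scope.

Section Graphs.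
Variable n : nat.

(* Simple graphs on 'I_n, given by their adjacency matrices. *)
Definition is_adjacency (a : 'M[bool]_n) : bool :=
  [forall u, forall v, a u v == a v u] && [forall u, ~~ a u u].

Record graph := Graph { adj :> 'M[bool]_n; adjP : is_adjacency adj }.
HB.instance Definition _ := [isSub for adj].

Definition degree (G : graph) (u : 'I_n) : nat := #|[pred v | G u v]|.

Definition max_degree_le (R : realType) (D : R) (G : graph) : Prop :=
  forall u, (degree G u)%:R <= D.

(* Rewiring the nodes of W means changing only rows and columns indexed by W. *)
Definition differ_within (W : {set 'I_n}) (G G' : graph) : bool :=
  [forall u, forall v, (u \notin W) && (v \notin W) ==> (G u v == G' u v)].

(* W = 'I_n, of cardinality n, always qualifies, so n is a neutral default. *)
Definition node_dist (G G' : graph) : nat :=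
  \big[minn/n]_(W : {set 'I_n} | differ_within W G G') #|W|.

Definition node_adj (G G' : graph) : Prop := (node_dist G G' <= 1)%N.

End Graphs.

Section DifferentialPrivacy.
Context d d' (Omega : measurableType d) (T : measurableType d') (R : realType).
Variables (P : probability Omega R) (n : nat).

(* A randomized algorithm on graphs is a map M : graph n -> Omega -> T, where
   (Omega, P) carries its randomness; K is the class of graphs on which the
   privacy inequality is required. *)
Definition node_dp_on (K : graph n -> Prop) (eps delta : R)
    (M : graph n -> Omega -> T) : Prop :=
  forall G G', K G -> K G' -> node_adj G G' ->
  forall S : set T, measurable S ->
  (P [set w | S (M G w)] <= (expR eps)%:E * P [set w | S (M G' w)] + delta%:E)%E.

Definition node_dp (eps delta : R) (M : graph n -> Omega -> T) : Prop :=
  node_dp_on (fun=> True) eps delta M.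

Definition node_dp_bounded (D eps delta : R) (M : graph n -> Omega -> T) : Prop :=
  node_dp_on (max_degree_le (2 * D)) eps delta M.

End DifferentialPrivacy.

Section Truncation.
Variables (R : realType) (n : nat).

Definition lp_point : Type := {ffun 'I_n -> R} * 'M[R]_n.

(* The constraints at u = v force w u u = 0 and are otherwise vacuous. *)
Definition lp_feasible (D : R) (G : graph n) (p : lp_point) : Prop :=
  let: (x, w) := p in
  [/\ forall u, 0 <= x u,
      forall u v, w u v = w v u,
      forall u v, 0 <= w u v,
      forall u v, (G u v)%:R - x u - x v <= w u v <= (G u v)%:R
    & forall u, \sum_(v | v != u) w u v <= D].

Definition lp_value (p : lp_point) : R := \sum_u p.1 u.

Definition lp_optimal (D : R) (G : graph n) (p : lp_point) : Prop :=
  lp_feasible D G p /\ forall q, lp_feasible D G q -> lp_value p <= lp_value q.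

(* [opt] is the deterministic rule selecting an optimal solution. *)
Variable opt : graph n -> lp_point.

Definition removed (G : graph n) (u : 'I_n) : bool := 4^-1 <= (opt G).1 u.

Definition trunc_adj (G : graph n) : 'M[bool]_n :=
  \matrix_(u, v) (G u v && ~~ (removed G u || removed G v)).

Lemma trunc_adjP (G : graph n) : is_adjacency (trunc_adj G).
Proof.
have /andP[/forallP sG /forallP iG] := adjP G.
apply/andP; split; apply/forallP => u; last by rewrite mxE (negbTE (iG u)).
apply/forallP => v; rewrite !mxE orbC.
by have /forallP/(_ v)/eqP -> := sG u.
Qed.

Definition trunc (G : graph n) : graph n := Graph (trunc_adjP G).

Definition trunc_dist (G : graph n) : R := 4 * lp_value (opt G).

(* z is the realized value of the Laplace noise. *)
Definition L_hat (eps delta : R) (G : graph n) (z : R) : R :=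
  Num.max 2^-1 (5 + 2 * trunc_dist G + z + 8 * ln (1 / delta) / eps).

Definition private_pair (Omega Seed T : Type)
    (A : R -> R -> graph n -> Seed -> T) (eps1 delta1 eps2 delta2 : R)
    (Z : Omega -> R) (W : Omega -> Seed) (G : graph n) (w : Omega) : R * T :=
  let L := L_hat eps1 delta1 G (Z w) in
  (L, A (eps2 / L) (delta2 / L) (trunc G) (W w)).

End Truncation.

Section Randomness.
Context d (Omega : measurableType d) (R : realType) (P : probability Omega R).

Definition laplace_pdf (b x : R) : R := (2 * b)^-1 * expR (- `|x| / b).

Definition laplace_distributed (b : R) (Z : {RV P >-> R}) : Prop :=
  forall B : set R, measurable B ->
  distribution P Z B = (\int[lebesgue_measure]_(x in B) (laplace_pdf b x)%:E)%E.

Definition independent_RVs d1 d2 (T1 : measurableType d1)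
    (T2 : measurableType d2) (X : {RV P >-> T1}) (Y : {RV P >-> T2}) : Prop :=
  forall (B : set T1) (C : set T2), measurable B -> measurable C ->
  (P (X @^-1` B `&` Y @^-1` C) = P (X @^-1` B) * P (Y @^-1` C))%E.

End Randomness.

(* 'Theta compares absolute values, hence the separate positivity clause; at
   n = 0 the power n%:R `^ alpha vanishes, so nothing is required there. *)
Definition is_poly (R : realType) (p : nat -> R) : Prop :=
  (forall n, (0 < n)%N -> 0 < p n) /\
  exists2 alpha : R, 0 < alpha &
    (p : nat -> R^o) \is 'Theta_\oo (fun n : nat => n%:R `^ alpha : R^o).

(* Main.v *)
Require Import Defs.
From HB Require Import structures.
From mathcomp Require Import all_boot all_order all_algebra.
From mathcomp Require Import all_classical all_reals all_analysis.
From mathcomp Require Import measurable_realfun ring lra.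

(** The proof splits the privacy loss between the two coordinates by conditioning
    in two different orders.

    The noisy value [L = max (1/2) (Z + c G)] has a center [c G] that moves by at
    most 8 when one node is rewired: an optimal solution of the linear program
    for one graph becomes feasible for the other at the price of setting one
    [x_u] to 1 ([trunc_dist_sensitivity]). Translating the Laplace noise of scale
    [8 / eps1] by at most 8 costs a factor [expR eps1] for every fixed value of
    the seed, whatever the output computed from [L] and the seed
    ([laplace_translation]).

    For a fixed value of the noise, hence of [L], what remains to compare is the
    same algorithm run on two truncated graphs. The removed nodes number at most
    [trunc_dist], so these graphs are joined by at most
    [5 + 2 * trunc_dist G] rewirings of single nodes. The intermediate graphs can
    be chosen as subgraphs of the two ends ([walk_isolated]), hence of maximum
    degree at most [2 * D]: this is what makes the bounded-degree privacy of the
    algorithm applicable at each step, with no loss in the length of the path.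
    With parameters [eps2 / L] and [delta2 / L] a path of length at most [L]
    costs a factor [expR (2 * eps2)] and an additive term
    [delta2 * expR (2 * eps2)], which the hypothesis on [eps2] bounds by
    [(p n)^-1] ([walk_scaled_dp]). So the same [p] serves in the conclusion.

    The offset [8 * ln (1 / delta1) / eps1] in [L] guarantees that [L] dominates
    the length of the path except when the noise falls below minus this offset,
    which has probability at most [delta1] ([laplace_tail]); this exceptional
    event is charged to the additive term. [noisy_release] combines the two
    comparisons by integrating over the product of the laws of noise and seed,
    once in each order. *)

Set Implicit Arguments.
Unset Strict Implicit.
Unset Printing Implicit Defensive.

Import Order.TTheory GRing.Theory Num.Theory.
Import numFieldNormedType.Exports.

Local Open Scope classical_set_scope.
Local Open Scope ring_scope.

(** * Node distance and walks between graphs *)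

Section NodeWalks.
Variable n : nat.
Implicit Types (G H : graph n) (W : {set 'I_n}).

Lemma adjC G u v : G u v = G v u.
Proof. by have /andP[/forallP/(_ u)/forallP/(_ v)/eqP -> _] := adjP G. Qed.

Lemma graph_eq G H : (forall u v, G u v = H u v) -> G = H.
Proof. by move=> GH; apply: val_inj; apply/matrixP. Qed.

Lemma differ_withinC W G H : differ_within W G H = differ_within W H G.
Proof. by apply: eq_forallb => u; apply: eq_forallb => v; rewrite eq_sym. Qed.

Lemma node_dist_le W G H : differ_within W G H -> (node_dist G H <= #|W|)%N.
Proof. by move=> GH; rewrite /node_dist (bigminD1 W) // geq_minl. Qed.

(** The rewired set of a pair at distance 0 is empty, but a node may be added to
    it; positivity of [n] provides that node. *)
Lemma node_adj1P G H : (0 < n)%N ->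
  node_adj G H <-> exists u, differ_within [set u] G H.
Proof.
move=> n_gt0; split; last first.
  by case=> u /node_dist_le; rewrite cards1.
apply: contraPP => noW; apply/negP; rewrite -ltnNge.
have noW1 W : differ_within W G H -> (1 < #|W|)%N.
  move=> GH; rewrite ltnNge; apply/negP => W1.
  have [u sWu] : exists u, W \subset [set u]%SET.
    have [->|[u uW]] := finset.set_0Vmem W.
      by exists (Ordinal n_gt0); rewrite finset.sub0set.
    exists u; rewrite finset.subEproper; apply/orP; left.
    by rewrite eq_sym eqEcard finset.sub1set uW cards1.
  apply: noW; exists u; apply/forallP => v; apply/forallP => w.
  apply/implyP => /andP[/(contra ((fintype.subsetP sWu) v)) vW].
  move=> /(contra ((fintype.subsetP sWu) w)) wW.
  by have /forallP/(_ v)/forallP/(_ w) := GH; rewrite vW wW.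
rewrite /node_dist; apply: (big_ind (fun k => 1 < k)%N).
- rewrite -[n]card_ord -cardsT; apply: noW1.
  by apply/forallP => u; apply/forallP => v; rewrite finset.in_setT.
- by move=> a b a1 b1; rewrite leq_min a1.
- by move=> W /noW1.
Qed.

Lemma node_adjC G H : (0 < n)%N -> node_adj G H -> node_adj H G.
Proof.
move=> n0 /(node_adj1P _ _ n0)[u uGH]; apply/node_adj1P => //.
by exists u; rewrite differ_withinC.
Qed.

(** Rewirings of one node at a time, all intermediate graphs lying in [K]:
    group privacy is paid once per step, and only inside [K]. *)
Inductive walk (K : graph n -> Prop) : nat -> graph n -> graph n -> Prop :=
| walk0 G : K G -> walk K 0 G G
| walkS m G H G' :
    K G -> node_adj G H -> walk K m H G' -> walk K m.+1 G G'.

Lemma walk_trans (K : graph n -> Prop) m1 m2 G H G' :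
  walk K m1 G H -> walk K m2 H G' -> walk K (m1 + m2) G G'.
Proof.
move=> w1; elim: w1 G' => [//|{}m {}G H' G1 KG GH' _ IH] G' /IH w2.
by rewrite addSn; exact: (walkS KG GH').
Qed.

Lemma walk1 (K : graph n -> Prop) G H :
  K G -> K H -> node_adj G H -> walk K 1 G H.
Proof. by move=> KG KH GH; apply: (walkS KG GH); exact: walk0. Qed.

Lemma walk_end (K : graph n -> Prop) m G H : walk K m G H -> K H.
Proof. by elim. Qed.

Lemma walkC (K : graph n -> Prop) m G H : (0 < n)%N ->
  walk K m G H -> walk K m H G.
Proof.
move=> n0; elim=> [{}G KG|{}m {}G H' G' KG GH' w IH]; first exact: walk0.
rewrite -addn1; apply: (walk_trans IH); apply: walk1 => //.
  exact: walk_end IH.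
exact: node_adjC.
Qed.

Definition isolate_adj W G : 'M[bool]_n :=
  \matrix_(u, v) [&& G u v, u \notin W & v \notin W].

Lemma isolate_adjP W G : is_adjacency (isolate_adj W G).
Proof.
have /andP[_ /forallP iG] := adjP G.
apply/andP; split; apply/forallP => u; last by rewrite mxE (negbTE (iG u)).
by apply/forallP => v; rewrite !mxE adjC andbA andbAC -andbA.
Qed.

Definition isolate W G : graph n := Graph (isolate_adjP W G).

Lemma isolateE W G u v : isolate W G u v = [&& G u v, u \notin W & v \notin W].
Proof. exact: mxE. Qed.

Lemma isolate0 G : isolate finset.set0 G = G.
Proof. by apply: graph_eq => u v; rewrite isolateE !finset.in_set0 !andbT. Qed.

Lemma isolateU W W' G : isolate (W :|: W') G = isolate W' (isolate W G).
Proof.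
apply: graph_eq => u v; rewrite !isolateE !finset.in_setU !negb_or.
rewrite -!andbA; congr (_ && _).
by rewrite !andbA; congr (_ && _); rewrite andbAC.
Qed.

Lemma differ_isolate1 u G : differ_within [set u] G (isolate [set u] G).
Proof.
apply/forallP => v; apply/forallP => w; apply/implyP => /andP[uv uw].
by rewrite isolateE uv uw !andbT.
Qed.

Lemma differ_within_isolate W W' G H :
  differ_within W G H -> differ_within W (isolate W' G) (isolate W' H).
Proof.
move=> GH; apply/forallP => v; apply/forallP => w; apply/implyP => vw.
by have /forallP/(_ v)/forallP/(_ w) := GH; rewrite vw !isolateE => /eqP ->.
Qed.

Section Hereditary.
Variable K : graph n -> Prop.
Hypothesis Kiso : forall W G, K G -> K (isolate W G).
Hypothesis n_gt0 : (0 < n)%N.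

Lemma walk_isolate W G : K G -> walk K #|W| G (isolate W G).
Proof.
have [k cW] : exists k, #|W| = k by exists #|W|.
rewrite cW; elim: k W cW G => [|k IH] W cW G KG.
  by rewrite (cards0_eq cW) isolate0; exact: walk0.
have [u uW] : exists u, u \in W by apply/set0Pn; rewrite -card_gt0 cW.
rewrite -(finset.setD1K uW) isolateU; apply: (walkS (H := isolate [set u] G)) => //.
  by apply/node_adj1P => //; exists u; exact: differ_isolate1.
apply: IH; last exact: Kiso.
by apply/eqP; rewrite -eqSS -cW (cardsD1 u W) uW.
Qed.

(** Nodes that are isolated on one side are isolated one by one on the other
    side, the single rewired node is changed while [W] and [W'] are both
    isolated, and the nodes of [W] are then given back their edges. Each
    intermediate graph is a subgraph of one of the two ends, so the walk stays in
    every class closed under isolation; rewiring the nodes directly, one by one,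
    could double the degrees. *)
Lemma walk_isolated W W' G G' : node_adj G G' ->
  K (isolate W G) -> K (isolate W' G') ->
  walk K (#|W'| + 1 + #|W|) (isolate W G) (isolate W' G').
Proof.
move=> /(node_adj1P _ _ n_gt0)[u uGG'] KG KG'.
apply: (@walk_trans K _ _ _ (isolate W (isolate W' G'))); last first.
  by apply: walkC => //; exact: walk_isolate.
apply: (walk_trans (walk_isolate W' KG)).
apply: walk1; [exact: Kiso|exact: Kiso|].
apply/node_adj1P => //; exists u.
by rewrite -!isolateU finset.setUC; exact: differ_within_isolate.
Qed.

End Hereditary.

Lemma max_degree_le_isolate (R : realType) (D : R) W G :
  max_degree_le D G -> max_degree_le D (isolate W G).
Proof.
move=> dG u; apply: le_trans (dG u); rewrite ler_nat; apply: subset_leq_card.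
by apply/fintype.subsetP => v; rewrite !inE isolateE => /andP[].
Qed.

End NodeWalks.

(** * Sensitivity of the linear program and degree truncation *)

Section Truncation.
Variables (R : realType) (n : nat) (D : R).
Implicit Types (G H : graph n) (p : lp_point R n).

(** With [x_u = 1] at the rewired node the lower bounds on the weights at [u] are
    void whatever the edges at [u], so that these weights can be set to zero. *)
Definition lp_pay (u : 'I_n) p : lp_point R n :=
  ([ffun v => if v == u then 1 else p.1 v],
   \matrix_(v, w) if (v == u) || (w == u) then 0 else p.2 v w).

Lemma lp_pay_feasible u G H p : differ_within [set u] G H ->
  lp_feasible D H p -> lp_feasible D G (lp_pay u p).
Proof.
case: p => x w GH [x0 wC w0 wG wD]; split => /=.
- by move=> v; rewrite ffunE; case: ifP.
- by move=> v v'; rewrite !mxE orbC wC.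
- by move=> v v'; rewrite !mxE; case: ifP.
- move=> v v'; rewrite !mxE !ffunE; have [vu|] := boolP ((v == u) || (v' == u)).
    rewrite ler0n andbT /=.
    have Gle1 : (G v v')%:R <= 1 :> R by case: (G v v').
    have := x0 v; have := x0 v'; move: Gle1.
    by case/orP: vu => [/eqP->|/eqP->]; rewrite eqxx; case: ifP => _; lra.
  rewrite negb_or => /andP[vu v'u]; rewrite (negbTE vu) (negbTE v'u).
  have /forallP/(_ v)/forallP/(_ v') := GH.
  by rewrite !finset.in_set1 vu v'u => /eqP ->.
- move=> v; apply: le_trans (wD v); apply: ler_sum => v' _; rewrite mxE.
  by case: ifP.
Qed.

Lemma lp_value_pay u p : (forall v, 0 <= p.1 v) ->
  lp_value (lp_pay u p) <= 1 + lp_value p.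
Proof.
move=> p0; rewrite /lp_value (bigD1 u) //= ffunE eqxx [in leRHS](bigD1 u) //=.
rewrite addrCA ler_wpDl // lerD2l; apply: ler_sum => v vu.
by rewrite ffunE (negbTE vu).
Qed.

Variable opt : graph n -> lp_point R n.
Hypothesis opt_optimal : forall G, lp_optimal D G (opt G).

Lemma opt_ge0 G u : 0 <= (opt G).1 u.
Proof. by have [+ _] := opt_optimal G; case: (opt G) => x w []. Qed.

Lemma trunc_dist_sensitivity G H : (0 < n)%N -> node_adj G H ->
  trunc_dist opt G <= 4 + trunc_dist opt H.
Proof.
move=> n0 /(node_adj1P _ _ n0)[u uGH].
have [_ Gmin] := opt_optimal G; have [Hf _] := opt_optimal H.
have := Gmin _ (lp_pay_feasible uGH Hf).
have := lp_value_pay u (opt_ge0 H).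
rewrite /trunc_dist; lra.
Qed.

Definition removed_set G : {set 'I_n} := [set u | removed opt G u]%SET.

Lemma trunc_isolate G : trunc opt G = isolate (removed_set G) G.
Proof.
by apply: graph_eq => u v; rewrite isolateE !mxE !inE negb_or.
Qed.

(** A removed node has [4 * x_u >= 1]. *)
Lemma card_removed_set G : #|removed_set G|%:R <= trunc_dist opt G.
Proof.
rewrite -sum1_card natr_sum /trunc_dist /lp_value mulr_sumr.
rewrite [leRHS](bigID (mem (removed_set G))) /= -[leLHS]addr0; apply: lerD.
  apply: ler_sum => u; rewrite inE /removed; lra.
by apply: sumr_ge0 => u _; rewrite mulr_ge0 // opt_ge0.
Qed.

(** An edge between two kept nodes has [w > 1/2], and the weights at a node sum
    to at most [D]. *)
Lemma trunc_max_degree G : 0 <= D -> max_degree_le (2 * D) (trunc opt G).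
Proof.
move=> D0 u; rewrite /degree -sum1_card natr_sum.
have [+ _] := opt_optimal G; case E : (opt G) => [x w] [x0 wC w0 wG wD].
have := wD u; rewrite -(ler_pM2l (x := 2)) //; apply: le_trans.
rewrite mulr_sumr [leLHS]big_mkcond [leRHS]big_mkcond /=; apply: ler_sum => v _.
rewrite inE mxE /removed E /= negb_or -!ltNge.
have [->|vu] := eqVneq v u.
  by have /andP[_ /forallP/(_ u)/negbTE ->] := adjP G.
have := w0 u v; have /andP[+ _] := wG u v.
case: (G u v) => /=; last by lra.
by case: ifP => [/andP[]|]; lra.
Qed.

(** Removed nodes are isolated in the truncation, so [walk_isolated] applies with
    [W] and [W'] the two sets of removed nodes. The constant 5 is 1 for the
    rewired node plus 4 for replacing one [trunc_dist] by the other. *)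
Lemma walk_trunc G H : (0 < n)%N -> 0 <= D -> node_adj G H ->
  exists2 m, m%:R <= 5 + 2 * trunc_dist opt G
    & walk (max_degree_le (2 * D)) m (trunc opt G) (trunc opt H).
Proof.
move=> n0 D0 GH; exists (#|removed_set H| + 1 + #|removed_set G|)%N.
  rewrite !natrD.
  have := card_removed_set G; have := card_removed_set H.
  by have := trunc_dist_sensitivity n0 (node_adjC n0 GH); lra.
have dG := trunc_max_degree G D0; have dH := trunc_max_degree H D0.
rewrite !trunc_isolate in dG dH *.
by apply: walk_isolated => // W G'; exact: max_degree_le_isolate.
Qed.

End Truncation.

(** * Group privacy along a walk *)

Lemma walk_node_dp d d' (Omega : measurableType d) (T : measurableType d')
    (R : realType) (P : probability Omega R) n (K : graph n -> Prop)
    (eps delta : R) (M : graph n -> Omega -> T) m G H (S : set T) :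
  0 <= eps -> 0 <= delta -> node_dp_on P K eps delta M -> walk K m G H ->
  measurable S ->
  (P [set w | S (M G w)] <= (expR (m%:R * eps))%:E * P [set w | S (M H w)]
                            + (m%:R * expR (m%:R * eps) * delta)%:E)%E.
Proof.
move=> e0 d0 dpM wGH mS; elim: wGH => [{}G _|{}m {}G G1 {}H KG GG1 w IH].
  by rewrite mul0r expR0 mul1e !mul0r adde0.
have KG1 : K G1 by case: w.
apply: (le_trans (dpM _ _ KG KG1 GG1 _ mS)).
have -> : m.+1%:R * eps = eps + m%:R * eps by rewrite -natr1 mulrDl mul1r addrC.
apply: (@le_trans _ _ ((expR eps)%:E *
  ((expR (m%:R * eps))%:E * P [set w | S (M H w)]
   + (m%:R * expR (m%:R * eps) * delta)%:E) + delta%:E)%E).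
  by apply: leeD => //; apply: lee_wpmul2l => //; rewrite lee_fin expR_ge0.
rewrite ge0_muleDr; last 2 first.
- by rewrite mule_ge0 // lee_fin expR_ge0.
- by rewrite lee_fin !mulr_ge0 // expR_ge0.
rewrite muleA -!EFinM -expRD -addeA; apply: leeD => //.
rewrite -EFinD lee_fin mulrA mulrCA -expRD -natr1 mulrDl mul1r [leRHS]mulrDl.
rewrite lerD2l ler_peMl // -[leLHS]expR0 ler_expR.
by rewrite addr_ge0 // mulr_ge0.
Qed.

(** * Laplace noise *)

Section Laplace.
Variable R : realType.
Local Notation mu := (@lebesgue_measure R).
Local Notation translate c := ((+%R^~ c) : measurableTypeR R -> measurableTypeR R).

Lemma measurable_translate (c : R) : measurable_fun [set: R] (translate c).
Proof. by apply: measurable_funD. Qed.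

Lemma lebesgue_measure_translate (c : R) (A : set R) : measurable A ->
  pushforward mu (translate c) A = mu A.
Proof.
move=> mA; apply/esym/(@lebesgue_measure_unique _
  (pushforward mu (translate c))) => //=; first exact: measurable_translate.
move=> _ _ [[a b]] _ <-; rewrite /pushforward.
have -> : (fun x : R => x + c) @^-1` `]a, b]%classic = `]a - c, b - c]%classic.
  by apply/seteqP; split => x /=; rewrite !in_itv /= ltrBlDr lerBrDr.
rewrite !lebesgue_measure_itv /= !lte_fin ltrD2r.
by case: ifP => // _; rewrite -!EFinB; congr EFin; lra.
Qed.

Lemma laplace_pdf_ge0 (b x : R) : 0 < b -> 0 <= laplace_pdf b x.
Proof.
by move=> b0; rewrite mulr_ge0 ?expR_ge0 // invr_ge0 mulr_ge0 // ltW.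
Qed.

Lemma measurable_laplace_pdf (b : R) :
  measurable_fun [set: R] (laplace_pdf b).
Proof.
rewrite /laplace_pdf; apply: measurable_funM => //.
apply: measurableT_comp => //; apply: measurable_funM => //.
exact: measurableT_comp.
Qed.

Context d (Omega : measurableType d) (P : probability Omega R).
Variables (b : R) (Z : {RV P >-> R}).
Hypothesis b_gt0 : 0 < b.
Hypothesis Z_laplace : laplace_distributed b Z.

(** By translation invariance of the Lebesgue measure, a pointwise comparison of
    the density with its translate on [B] passes to the law. Both the privacy of
    the noise and its tail bound are instances. *)
Lemma laplace_translate_le (c k : R) (B : set R) : 0 <= k -> measurable B ->
  (forall y, B y -> laplace_pdf b (y - c) <= k * laplace_pdf b y) ->
  (distribution P Z (translate c @^-1` B) <= k%:E * distribution P Z B)%E.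
Proof.
move=> k0 mB ratio.
have mBc : measurable (translate c @^-1` B).
  by rewrite -[X in measurable X]setTI; exact: measurable_translate.
rewrite !Z_laplace //.
have mpdf (D : set R) : measurable_fun D (fun y => (laplace_pdf b y)%:E).
  apply/measurable_EFinP; apply: measurable_funTS.
  exact: measurable_laplace_pdf.
have mpdfc : measurable_fun B (fun y => (laplace_pdf b (y - c))%:E).
  apply/measurable_EFinP/measurable_funTS.
  apply: (measurableT_comp (measurable_laplace_pdf b)).
  exact: (measurable_translate (- c)).
have -> : (\int[mu]_(x in translate c @^-1` B) (laplace_pdf b x)%:E =
    \int[mu]_(y in B) (laplace_pdf b (y - c))%:E)%E.
  transitivity (\int[pushforward mu (translate c)]_(y in B)
      (laplace_pdf b (y - c))%:E)%E.
    rewrite ge0_integral_pushforward //=; first last.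
    - by move=> y _; rewrite lee_fin laplace_pdf_ge0.
    - exact: measurable_translate.
    by apply: eq_integral => x _; rewrite /= addrK.
  have mtc : measurable_fun [set: measurableTypeR R] (translate c).
    by move=> mT Y mY; exact: measurable_translate.
  apply: eq_measure_integral => //=.
  by move=> A mA _; rewrite -[RHS](lebesgue_measure_translate c).
rewrite -ge0_integralZl //; first last.
- by move=> y _; rewrite lee_fin laplace_pdf_ge0.
- exact: mpdf.
apply: ge0_le_integral => //.
- by move=> y _; rewrite lee_fin laplace_pdf_ge0.
- by apply: measurable_funeM; exact: mpdf.
Qed.

(** The density is [expR] of a [b^-1]-Lipschitz function, up to a constant. *)
Lemma laplace_translation (c : R) (B : set R) : measurable B ->
  (distribution P Z (translate c @^-1` B)
   <= (expR (`|c| / b))%:E * distribution P Z B)%E.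
Proof.
move=> mB; apply: laplace_translate_le => // y _.
rewrite /laplace_pdf mulrCA -expRD ler_pM2l ?invr_gt0 ?mulr_gt0 // ler_expR.
rewrite -mulrDl ler_pM2r ?invr_gt0 //.
by have := ler_normD (y - c) c; rewrite subrK; lra.
Qed.

(** The event is the negative half-line translated by [- t], and on the negative
    half-line that translation multiplies the density by exactly [expR (- t / b)].
    Bounding the mass of the half-line by 1 instead of 1/2 is enough. *)
Lemma laplace_tail (t : R) : 0 <= t ->
  (distribution P Z [set z : R | (z < - t)%R] <= (expR (- t / b))%:E)%E.
Proof.
move=> t0.
have -> : [set z : R | z < - t] = translate t @^-1` `]-oo, 0[%classic.
  by apply/seteqP; split => z /=; rewrite in_itv /= -ltrBrDr sub0r.
apply: (@le_trans _ _ ((expR (- t / b))%:E * distribution P Z `]-oo, 0%R[)%E).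
  apply: laplace_translate_le => // y.
  rewrite /= in_itv /= => y0; rewrite /laplace_pdf mulrCA -expRD -mulrDl.
  rewrite ler_pM2l ?invr_gt0 ?mulr_gt0 // ler_expR ler_pM2r ?invr_gt0 //.
  by rewrite !ler0_norm; lra.
by rewrite -[leRHS]mule1 lee_wpmul2l ?probability_le1 // lee_fin expR_ge0.
Qed.

End Laplace.

(** * Release of a noisy value together with a seed-dependent output *)

Section JointLaw.
Context d dW (Omega : measurableType d) (Seed : measurableType dW).
Variables (R : realType) (P : probability Omega R).
Variables (Z : {RV P >-> R}) (W : {RV P >-> Seed}).
Hypothesis indepZW : independent_RVs Z W.

Lemma independent_joint (X : set (R * Seed)) : measurable X ->
  (P [set w | X (Z w, W w)] = (distribution P Z \x distribution P W) X)%E.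
Proof.
move=> mX.
have mZW : measurable_fun [set: Omega] (fun w => (Z w, W w)).
  by apply: measurable_fun_pair.
apply/esym.
by apply: (@product_measure_unique _ _ _ _ _ _ _
  (pushforward P (fun w => (Z w, W w)))).
Qed.

(** [U] and [U'] are the events, on (noisy value, seed), that the two outputs fall
    in a given set. Passing from [U] to [U'] is done for a fixed noise, with the
    seed integrated first; passing from [c] to [c'] is done for a fixed seed, with
    the noise integrated first. Sections are compared only above [m], which the
    noisy value reaches unless the noise is below [- t]. *)
Lemma noisy_release (b t m c c' k beta : R) (U U' : set (R * Seed)) :
  0 < b -> laplace_distributed b Z -> 0 <= t -> 0 <= k -> 0 <= beta ->
  measurable U -> measurable U' -> m + t <= c ->
  (forall l, m <= l ->
    (distribution P W (xsection U l) <=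
     k%:E * distribution P W (xsection U' l) + beta%:E)%E) ->
  (P [set w | U ((Z w + c)%R, W w)] <=
   (expR (`|c - c'| / b) * k)%:E * P [set w | U' ((Z w + c')%R, W w)]
   + (beta + expR (- t / b))%:E)%E.
Proof.
move=> b0 hZ t0 k0 beta0 mU mU' mtc hsec.
have mtr e : measurable_fun [set: R * Seed] (fun z : R * Seed => (z.1 + e, z.2)).
  apply: measurable_fun_pair => //.
  by apply: measurable_funD.
pose X e (V : set (R * Seed)) : set (R * Seed) := [set z | V ((z.1 + e)%R, z.2)].
have mX e V : measurable V -> measurable (X e V).
  by move=> mV; rewrite -[X e V]setTI; exact: mtr.
have xX e V z : xsection (X e V) z = xsection V (z + e).
  by rewrite !xsectionE.
have PX e V : measurable V ->
    (P [set w | V ((Z w + e)%R, W w)] =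
     (distribution P Z \x distribution P W) (X e V))%E.
  by move=> mV; rewrite -independent_joint //; exact: mX.
rewrite !PX //.
have shift : ((distribution P Z \x distribution P W) (X c U') <=
    (expR (`|c - c'| / b))%:E *
    (distribution P Z \x distribution P W) (X c' U'))%E.
  have swap V : measurable V ->
      ((distribution P Z \x distribution P W) V =
       (distribution P Z \x^ distribution P W) V)%E.
    move=> mV; apply: product_measure_unique => // A B mA mB.
    exact: product_measure2E.
  rewrite !swap; [|exact: mX..].
  rewrite /product_measure2 -ge0_integralZl //=; last first.
    by apply: measurable_fun_ysection; exact: mX.
  apply: ge0_le_integral => //=.
  - by apply: measurable_fun_ysection; exact: mX.
  - by apply: measurable_funeM; apply: measurable_fun_ysection; exact: mX.
  move=> s _.
  have -> : ysection (X c U') s = (+%R^~ (c - c')) @^-1` ysection (X c' U') s.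
    by rewrite !ysectionE; apply/seteqP; split => z; rewrite /X /= -addrA subrK.
  by apply: laplace_translation => //; apply: measurable_ysection; exact: mX.
(* On the bad event the section is only known to have mass at most 1, hence the
   indicator in the pointwise bound below. *)
have sections : ((distribution P Z \x distribution P W) (X c U) <=
    k%:E * (distribution P Z \x distribution P W) (X c U')
    + (beta + expR (- t / b))%:E)%E.
  pose bad : set R := [set z | z < - t].
  have mbad : measurable bad.
    have -> : bad = `]-oo, - t[%classic.
      by apply/seteqP; split => z; rewrite /bad /= in_itv.
    exact: measurable_itv.
  have mU'c : measurable_fun [set: R]
      (fun z => distribution P W (xsection (X c U') z)).
    by apply: measurable_fun_xsection; exact: mX.
  apply: (@le_trans _ _ (\int[distribution P Z]_z
    (k%:E * distribution P W (xsection (X c U') z)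
     + (beta%:E + (\1_bad z)%:E)))%E).
    apply: ge0_le_integral => //=.
    - by apply: measurable_fun_xsection; exact: mX.
    - apply: emeasurable_funD; first exact: measurable_funeM.
      by apply: emeasurable_funD => //; exact/measurable_EFinP.
    move=> z _; rewrite !xX.
    have [zt|tz] := ltP z (- t).
      rewrite indicE mem_set //; apply: (@le_trans _ _ 1%E).
        by apply: probability_le1; apply: measurable_xsection.
      by rewrite addeA leeDr // adde_ge0 ?mule_ge0 ?lee_fin.
    apply: le_trans (hsec (z + c) _) _; first by lra.
    by rewrite addeA leeDl // lee_fin.
  rewrite ge0_integralD //=; last 4 first.
  - by move=> z _; rewrite mule_ge0 ?lee_fin.
  - exact: measurable_funeM.
  - by move=> z _; rewrite adde_ge0 ?lee_fin.
  - by apply: emeasurable_funD => //; exact/measurable_EFinP.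
  rewrite ge0_integralZl //=.
  rewrite leeD2l // ge0_integralD //=; last first.
    exact/measurable_EFinP.
  rewrite integral_cst // integral_indic // setIT EFinD.
  apply: leeD; last exact: laplace_tail.
  by rewrite -[leRHS]mule1 lee_wpmul2l ?lee_fin ?probability_le1.
apply: (le_trans sections); rewrite leeD2r // mulrC EFinM -muleA.
by rewrite lee_wpmul2l ?lee_fin.
Qed.

End JointLaw.

(** * Privacy of the pair *)

(** The map from (noisy value, seed) to the output: the pair is this function of
    the unclamped [Z + c], which lets the center [c] be changed independently of
    the graph given to the algorithm. *)
Definition release (R : realType) (Seed T : Type) (A : R -> R -> Seed -> T)
    (eps delta : R) (z : R * Seed) : R * T :=
  let L := Num.max 2^-1 z.1 in (L, A (eps / L) (delta / L) z.2).

Lemma measurable_release (R : realType) dW dT (Seed : measurableType dW)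
    (T : measurableType dT) (A : R -> R -> Seed -> T) (eps delta : R) :
  measurable_fun [set: (R * R) * Seed]
    (fun z : (R * R) * Seed => A z.1.1 z.1.2 z.2) ->
  measurable_fun [set: R * Seed] (release A eps delta).
Proof.
move=> mA.
have mL : measurable_fun [set: R * Seed] (fun z => Num.max (2^-1 : R) z.1).
  by apply: measurable_maxr.
have mdivL (e : R) :
    measurable_fun [set: R * Seed] (fun z => e / Num.max (2^-1 : R) z.1).
  have -> : (fun z : R * Seed => e / Num.max 2^-1 z.1) =
      (fun z => e * Num.max 2^-1 z.1 `^ (-1)).
    by apply/funext => z; rewrite powR_inv1 // le_max invr_ge0 ler0n.
  apply: measurable_funM => //.
  have mpow : measurable_fun [set: R] (fun x : R => x `^ (-1)).
    exact: measurable_powR.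
  exact: (measurableT_comp mpow mL).
apply: measurable_fun_pair => //.
have margs : measurable_fun [set: R * Seed] (fun z =>
    ((eps / Num.max (2^-1 : R) z.1, delta / Num.max (2^-1 : R) z.1), z.2)).
  by apply: measurable_fun_pair => //; exact: measurable_fun_pair.
exact: (measurableT_comp mA margs).
Qed.

(** A walk of length [m <= L] costs [m * (2 eps / L) <= 2 eps] in the exponent,
    and an additive term at most [m * (delta / L) * expR (2 eps)]. *)
Lemma walk_scaled_dp d dT (Omega : measurableType d) (T : measurableType dT)
    (R : realType) (P : probability Omega R) n (D eps delta L : R)
    (M : graph n -> Omega -> T) m G H (S : set T) :
  0 < L -> 0 <= eps -> 0 <= delta -> m%:R <= L ->
  node_dp_bounded P D (2 * (eps / L)) (delta / L) M ->
  walk (max_degree_le (2 * D)) m G H -> measurable S ->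
  (P [set w | S (M G w)] <= (expR (2 * eps))%:E * P [set w | S (M H w)]
                            + (delta * expR (2 * eps))%:E)%E.
Proof.
move=> L0 e0 d0 mL dpM wGH mS.
have eL0 : 0 <= 2 * (eps / L) by rewrite mulr_ge0 // divr_ge0 // ltW.
have dL0 : 0 <= delta / L by rewrite divr_ge0 // ltW.
have mL1 : m%:R / L <= 1 by rewrite ler_pdivrMr // mul1r.
have cost : expR (m%:R * (2 * (eps / L))) <= expR (2 * eps).
  rewrite ler_expR (_ : _ * _ = (2 * eps) * (m%:R / L)); last by lra.
  by rewrite ler_piMr // mulr_ge0.
apply: le_trans (walk_node_dp eL0 dL0 dpM wGH mS) _.
apply: leeD; first by apply: lee_wpmul2r => //; rewrite lee_fin.
rewrite lee_fin mulrAC mulrC.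
rewrite (_ : _ * (delta / L) = delta * (m%:R / L)); last by lra.
rewrite mulrC; apply: ler_pM => //; rewrite ?expR_ge0 //.
  by rewrite mulr_ge0 // divr_ge0 // ltW.
by rewrite ler_piMr.
Qed.

Theorem theorem2 (R : realType) (p : nat -> R) (hp : is_poly p) :
  exists q : nat -> R, is_poly q /\
  forall (n : nat) (hn : (0 < n)%N) (D : R) (hD : 0 <= D)
    (* the deterministic rule choosing an optimal solution of the program *)
    (opt : graph n -> lp_point R n)
    (hopt : forall G, lp_optimal D G (opt G))
    (* probability space, Laplace noise Z, internal randomness W *)
    (d dW dT : measure_display) (Omega : measurableType d)
    (Seed : measurableType dW) (T : measurableType dT)
    (P : probability Omega R) (Z : {RV P >-> R}) (W : {RV P >-> Seed})
    (hindep : independent_RVs Z W)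
    (eps1 delta1 eps2 delta2 : R)
    (heps1 : 0 < eps1) (hdelta1 : 0 < delta1)
    (heps2 : 0 < eps2) (hdelta2 : 0 < delta2)
    (hZ : laplace_distributed (8 / eps1) Z)
    (A : R -> R -> graph n -> Seed -> T)
    (hmeas : forall G, measurable_fun [set: (R * R) * Seed]
       (fun z : (R * R) * Seed => A z.1.1 z.1.2 G z.2))
    (hA : forall eps delta : R, 0 < eps -> 0 < delta ->
       2 * eps < ln (1 / delta) ->
       node_dp_bounded P D (2 * eps) delta (fun G w => A eps delta G (W w)))
    (hpriv : 2 * eps2 < ln (1 / (delta2 * p n))),
  node_dp P (eps1 + 2 * eps2) (expR eps1 * ((q n)^-1 + delta1))
    (private_pair opt A eps1 delta1 eps2 delta2 Z W).
Proof.
exists p; split => // n n0 D D0 opt hopt d dW dT Omega Seed T P Z W indep.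
move=> eps1 delta1 eps2 delta2 e1 d1 e2 d2 hZ A mA hA hpriv G G' _ _ GG' S mS.
have pn0 : 0 < p n by have [+ _] := hp; exact.
pose t := 8 * ln (1 / delta1) / eps1.
pose c H := 5 + 2 * trunc_dist opt H + t.
pose U H := release (fun e d => A e d (trunc opt H)) eps2 delta2 @^-1` S.
have mU H : measurable (U H).
  by rewrite -[U H]setTI; apply: measurable_release => //; exact: mA.
have pairE H : [set w | S (private_pair opt A eps1 delta1 eps2 delta2 Z W H w)]
    = [set w | U H ((Z w + c H)%R, W w)].
  rewrite /U /release /private_pair /L_hat /=; apply/seteqP.
  have cE w : 5 + 2 * trunc_dist opt H + Z w + t = Z w + c H by rewrite /c; lra.
  by split => w /=; rewrite -/t cE.
have mpair H : measurable [set w | U H ((Z w + c H)%R, W w)].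
  have mZcW : measurable_fun [set: Omega] (fun w => (Z w + c H, W w)).
    by apply: measurable_fun_pair => //; exact: measurable_funD.
  by rewrite -[X in measurable X]setTI; exact: mZcW.
rewrite !pairE.
(* If [p n < 1] or [1 <= delta1], the additive term already exceeds 1; so [p]
   need not be normalized, and the offset [t] may be taken nonnegative. *)
have [small|] := boolP ((p n < 1) || (1 <= delta1)).
  have add_ge1 : 1 <= expR eps1 * ((p n)^-1 + delta1).
    rewrite mulr_ege1 //; first by rewrite -expR0 ler_expR ltW.
    have ip0 : 0 < (p n)^-1 by rewrite invr_gt0.
    case/orP: small => [pn1|]; last by lra.
    have : 1 <= (p n)^-1 by rewrite invf_ge1 // ltW.
    by lra.
  apply: (@le_trans _ _ 1%E); first exact: probability_le1.
  rewrite -[leLHS]add0e; apply: leeD; last by rewrite lee_fin.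
  by rewrite mule_ge0 // lee_fin expR_ge0.
rewrite negb_or -leNgt -ltNge => /andP[pn1 d11].
have t0 : 0 <= t.
  apply: divr_ge0; last exact: ltW.
  by apply: mulr_ge0 => //; apply: ln_ge0; rewrite div1r invf_ge1 // ltW.
have beta_le : delta2 * expR (2 * eps2) <= (p n)^-1.
  have dp0 : 0 < delta2 * p n by rewrite mulr_gt0.
  have : expR (2 * eps2) < 1 / (delta2 * p n).
    by rewrite -[ltRHS]lnK ?ltr_expR // posrE divr_gt0.
  rewrite ltr_pdivlMr // => h.
  by rewrite -[leRHS]mul1r ler_pdivlMr //; lra.
have sens : `|c G - c G'| <= 8.
  have := trunc_dist_sensitivity hopt n0 GG'.
  have := trunc_dist_sensitivity hopt n0 (node_adjC n0 GG').
  by rewrite /c => *; rewrite ler_norml; apply/andP; split; lra.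
have [m mG wGG'] := walk_trunc hopt n0 D0 GG'.
(* Here [L >= 1], which is why [delta2 / L] and [eps2 / L] inherit the condition
   required of [A] from the hypothesis on [eps2] and [delta2]. *)
have sections l : 5 + 2 * trunc_dist opt G <= l ->
    (distribution P W (xsection (U G) l) <=
     (expR (2 * eps2))%:E * distribution P W (xsection (U G') l)
     + ((p n)^-1)%:E)%E.
  move=> ml.
  have dist0 : 0 <= trunc_dist opt G.
    by apply: le_trans (card_removed_set hopt G).
  pose L : R := Num.max 2^-1 l.
  have Ll : L = l by apply/max_idPr; lra.
  pose SL := xsection S L.
  have mSL : measurable SL by exact: measurable_xsection.
  have secE H : distribution P W (xsection (U H) l) =
      P [set w | SL (A (eps2 / L) (delta2 / L) (trunc opt H) (W w))].
    by rewrite /distribution /pushforward /SL !xsectionE.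
  rewrite !secE.
  have L1 : 1 <= L by rewrite Ll; lra.
  have L0 : 0 < L by lra.
  have dpL : node_dp_bounded P D (2 * (eps2 / L)) (delta2 / L)
      (fun H w => A (eps2 / L) (delta2 / L) H (W w)).
    apply: hA; [by rewrite divr_gt0|by rewrite divr_gt0|].
    apply: (@le_lt_trans _ _ (2 * eps2)).
      by rewrite ler_pM2l // ler_pdivrMr // ler_peMr // ltW.
    apply: lt_le_trans hpriv _; rewrite ler_ln ?posrE ?divr_gt0 ?mulr_gt0 //.
    rewrite !div1r lef_pV2 ?posrE ?divr_gt0 ?mulr_gt0 //.
    rewrite ler_pdivrMr // -mulrA ler_peMr ?mulr_ege1 //; exact: ltW.
  have mL : m%:R <= L by rewrite Ll; lra.
  apply: le_trans (walk_scaled_dp L0 (ltW e2) (ltW d2) mL dpL wGG' mSL) _.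
  by rewrite leeD2l // lee_fin.
have b0 : 0 < 8 / eps1 by rewrite divr_gt0.
apply: le_trans (noisy_release (t := t) indep (c G') b0 hZ t0
  (expR_ge0 _) _ (mU G) (mU G') _ sections) _ => //.
  by rewrite invr_ge0 ltW.
have tailE : expR (- t / (8 / eps1)) = delta1.
  rewrite (_ : - t / _ = ln delta1) ?lnK ?posrE //.
  rewrite /t div1r lnV ?posrE //; field.
  by rewrite gt_eqF.
rewrite tailE; apply: leeD.
  rewrite lee_wpmul2r // lee_fin -expRD ler_expR lerD2r.
  by rewrite ler_pdivrMr // mulrCA divff ?mulr1 ?gt_eqF.
rewrite lee_fin ler_peMl ?addr_ge0 ?invr_ge0 ?ltW //.
by rewrite -expR0 ltr_expR.
Qed.
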